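(* For every integer $n \ge 1$, \[f(n,1) + f(n+1,2) + \cdots = \sum_{d \ge 1} f(n+d-1,d) = p(n-1),\] where the sum has only finitely many nonzero terms.
   Context: A partition of a positive integer $n$ is a finite sequence of positive integers $\lambda = (\lambda_1,\ldots,\lambda_j)$ with $\lambda_1 \ge \cdots \ge \lambda_j$ and $\sum_i \lambda_i = n$; the $\lambda_i$ are its parts. For integers $n \ge 1$ and $d \ge 1$, a partition $\lambda$ of $n$ has fixed point $d$ if $\lambda$ has at least $d$ parts and $\lambda_d = d$. Let $f(n,d)$ denote the number of partitions of $n$ with fixed point $d$. Let $p(n)$ denote the number of partitions of $n$, with the convention $p(0)=1$. *)

(* Defs.v *)
From HB Require Import structures.
From mathcomp Require Import all_boot.

Set Implicit Arguments.
Unset Strict Implicit.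
Unset Printing Implicit Defensive.

Definition is_intpart (n : nat) (s : seq nat) : bool :=
  [&& sorted geq s, all (fun i => 0 < i) s & sumn s == n].

(* Integer partitions; MathComp's [partition] is about finite sets. *)
Record intpart (n : nat) : Type :=
  IntPart { parts :> seq nat; _ : is_intpart n parts }.

HB.instance Definition _ n := [isSub for @parts n].
HB.instance Definition _ n := [Countable of intpart n by <:].

(* Finiteness: a partition of n has at most n parts, each of them at most n. *)

Lemma size_leq_sumn (s : seq nat) : all (fun i => 0 < i) s -> size s <= sumn s.
Proof.
elim: s => //= x s IHs /andP[x_gt0 /IHs le_s].
by rewrite -add1n leq_add.
Qed.

Lemma mem_leq_sumn (s : seq nat) i : i \in s -> i <= sumn s.
Proof.
elim: s => //= x s IHs; rewrite inE => /predU1P[-> | /IHs le_i].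
  exact: leq_addr.
exact: leq_trans le_i (leq_addl _ _).
Qed.

Section IntPartFinite.
Variable n : nat.
Implicit Type lam : intpart n.

Lemma intpart_size lam : size (map (@inord n) lam) <= n.
Proof.
by rewrite size_map; case: lam => s /= /and3P[_ /size_leq_sumn + /eqP <-].
Qed.

Definition bseq_of_intpart lam : n.-bseq 'I_n.+1 := Bseq (intpart_size lam).

Definition intpart_of_bseq (b : n.-bseq 'I_n.+1) : option (intpart n) :=
  insub (map val b).

Lemma bseq_of_intpartK : pcancel bseq_of_intpart intpart_of_bseq.
Proof.
move=> lam; rewrite /intpart_of_bseq /= -map_comp.
suff -> : map (val \o @inord n) lam = lam by rewrite valK.
rewrite -[RHS]map_id; apply/eq_in_map => i lam_i /=.
rewrite inordK // ltnS.
by case: lam lam_i => s /= /and3P[_ _ /eqP <-] /mem_leq_sumn.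
Qed.

HB.instance Definition _ : isFinite (intpart n) :=
  PCanIsFinite bseq_of_intpartK.

End IntPartFinite.

(* The part lambda_d, numbered from 1, is [nth 0 lam d.-1]. *)
Definition has_fixed_point (d : nat) (lam : seq nat) : bool :=
  (d <= size lam) && (nth 0 lam d.-1 == d).

(* Meaningful for d >= 1 only. *)
Definition f (n d : nat) : nat :=
  #|[pred lam : intpart n | has_fixed_point d lam]|.

Definition p (n : nat) : nat := #|{: intpart n}|.

Lemma p0 : p 0 = 1.
Proof.
apply/eqP/fintype1P; exists (@IntPart 0 [::] isT).
case=> [[|x s] lamP]; apply/val_inj => //=.
case/and3P: lamP => _ /= /andP[x_gt0 _].
by rewrite addn_eq0; case: x x_gt0.
Qed.

(* Main.v *)
Require Import Defs.
From mathcomp Require Import all_boot classical_sets cardinality fsbigop.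

Local Open Scope classical_set_scope.

(** Removing the part d from a partition of n + d - 1 with fixed point d leaves
    a partition mu of n - 1 in which fewer than d parts exceed d and at least
    d - 1 parts are at least d. Conversely, adding a part d to such a mu restores
    the fixed point. Since the number of parts of mu that are at least d is
    nonincreasing in d, exactly one d satisfies both conditions, so summing over
    d counts every partition of n - 1 once. *)

Lemma geq_trans : transitive geq.
Proof. by move=> y x z /= le_yx le_zy; apply: leq_trans le_zy le_yx. Qed.

Lemma geq_anti : antisymmetric geq.
Proof. by move=> x y /andP[le_yx le_xy]; apply/anti_leq/andP. Qed.

Lemma geq_total : total geq.
Proof. by move=> x y; apply: leq_total. Qed.

(** In a nonincreasing sequence the entries that are at least [m] form a prefix. Since [0 < m], the
    default 0 past the end also falls below [m]. *)
Lemma leq_nth_sorted (s : seq nat) (m i : nat) :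
  sorted geq s -> 0 < m -> (m <= nth 0 s i) = (i < count (leq m) s).
Proof.
move=> + m_gt0; elim: s i => [|x s IHs] i s_sorted.
  by rewrite nth_nil ltn0 leqNgt m_gt0.
have s_le_x : all (geq x) s by apply: order_path_min s_sorted; apply: geq_trans.
have {}IHs := IHs^~ (path_sorted s_sorted).
case: (leqP m x) => [le_mx | lt_xm].
  by case: i => [|i] /=; rewrite le_mx ?IHs.
suff -> : count (leq m) (x :: s) = 0.
  rewrite ltn0; apply/negbTE; rewrite -ltnNge.
  case: i => //= i; case: (ltnP i (size s)) => [lt_is | le_si].
    exact: leq_ltn_trans (allP s_le_x _ (mem_nth 0 lt_is)) lt_xm.
  by rewrite nth_default.
apply/eqP; rewrite eqn0Ngt -has_count /= negb_or -ltnNge lt_xm /=.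
by apply/hasPn=> y /(allP s_le_x) le_yx; rewrite -ltnNge (leq_ltn_trans le_yx).
Qed.

(** Counts depend only on the multiset of parts, so this form shows the effect of adding or removing
    a part without tracking positions. *)
Lemma has_fixed_point_count (d : nat) (s : seq nat) : sorted geq s -> 0 < d ->
  has_fixed_point d s = (count (leq d.+1) s < d <= count (leq d) s).
Proof.
move=> s_sorted d_gt0.
rewrite /has_fixed_point eqn_leq [nth _ _ _ <= d]leqNgt !leq_nth_sorted //.
rewrite -leqNgt -[count _ _ <= _]ltnS !prednK //.
case: (leqP d (count (leq d) s)) => [le_d | _]; last by rewrite !andbF.
by rewrite (leq_trans le_d) ?count_size.
Qed.

Lemma has_fixed_point_mem (d : nat) (s : seq nat) : 0 < d ->
  has_fixed_point d s -> d \in s.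
Proof.
by move=> d_gt0 /andP[le_ds /eqP <-]; rewrite mem_nth // prednK.
Qed.

(** The successor on the right accounts for the inserted part [d], which is at least [d] but not at
    least [d.+1]. *)
Definition has_fixed_point_slot (d : nat) (s : seq nat) : bool :=
  count (leq d.+1) s < d <= (count (leq d) s).+1.

Lemma has_fixed_point_insert (d : nat) (s t : seq nat) :
  sorted geq t -> 0 < d -> perm_eq t (d :: s) ->
  has_fixed_point d t = has_fixed_point_slot d s.
Proof.
move=> t_sorted d_gt0 /permP eq_ts.
by rewrite has_fixed_point_count // !eq_ts /= ltnn leqnn.
Qed.

(** If [d < e], every part at least [e] exceeds [d], so fewer than [d] parts are at least [e]; the
    slot condition at [e] then forces [e <= d]. *)
Lemma has_fixed_point_slot_uniq (s : seq nat) (d e : nat) :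
  has_fixed_point_slot d s -> has_fixed_point_slot e s -> d = e.
Proof.
wlog le_de : d e / d <= e => [IH dP eP|].
  by case/orP: (leq_total d e) => le_de; [|apply/esym]; apply: IH.
move=> /andP[lt_d _] /andP[_ le_e]; apply/eqP; rewrite eqn_leq le_de /=.
rewrite leqNgt; apply/negP => lt_de.
have /(leq_trans le_e) : (count (leq e) s).+1 <= d.
  by apply: leq_ltn_trans lt_d; apply: sub_count => x /(leq_trans lt_de).
by rewrite leqNgt lt_de.
Qed.

(** The largest [d] satisfying the upper bound works: failure of that bound at [d.+1] is exactly the
    strict inequality at [d]. *)
Lemma has_fixed_point_slot_ex (s : seq nat) :
  exists d, has_fixed_point_slot d s.
Proof.
pose P d := d <= (count (leq d) s).+1.
have exP : exists d, P d by exists 0.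
have ubP d : P d -> d <= (size s).+1.
  by move=> /leq_trans-> //; rewrite ltnS count_size.
case: (ex_maxnP exP ubP) => d Pd maxd.
exists d; apply/andP; split=> //; rewrite ltnNge; apply/negP => le_d.
by have := maxd d.+1; rewrite /P ltnS ltnn => /(_ le_d).
Qed.

Lemma has_fixed_point_slot_bounds (d : nat) (s : seq nat) :
  has_fixed_point_slot d s -> 0 < d <= (size s).+1.
Proof.
case/andP=> lt_d le_d; rewrite (leq_trans _ lt_d) //.
by rewrite (leq_trans le_d) // ltnS count_size.
Qed.

Lemma is_intpart_insert (n d : nat) (s t : seq nat) :
  0 < d -> sorted geq s -> sorted geq t -> perm_eq t (d :: s) ->
  is_intpart (n + d) t = is_intpart n s.
Proof.
move=> d_gt0 s_sorted t_sorted eq_ts.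
rewrite /is_intpart s_sorted t_sorted (perm_all _ eq_ts) (perm_sumn eq_ts) /=.
by rewrite d_gt0 addnC eqn_add2r.
Qed.

Lemma intpart_sorted (n : nat) (lam : intpart n) : sorted geq lam.
Proof. by case: lam => s /= /and3P[]. Qed.

Lemma intpart_size_leq (n : nat) (lam : intpart n) : size lam <= n.
Proof. by case: lam => s /= /and3P[_ /size_leq_sumn + /eqP <-]. Qed.

Lemma is_intpart_add_part (n d : nat) (mu : intpart n) :
  0 < d -> is_intpart (n + d) (sort geq (d :: mu)).
Proof.
move=> d_gt0; rewrite (is_intpart_insert _ _ mu) ?intpart_sorted ?perm_sort //.
  exact: valP mu.
exact: sort_sorted geq_total _.
Qed.

Definition add_part (n d : nat) (d_gt0 : 0 < d) (mu : intpart n) :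
  intpart (n + d) := IntPart (is_intpart_add_part n d mu d_gt0).

(** Sorting keeps the multiset of parts; cancelling [d] leaves that of [mu], which determines a
    sorted sequence. *)
Lemma add_part_inj (n d : nat) (d_gt0 : 0 < d) :
  injective (add_part n d d_gt0).
Proof.
move=> mu nu /(congr1 (@parts _)) /= eq_sort; apply/val_inj.
apply: (sorted_eq geq_trans geq_anti) (intpart_sorted _ _) (intpart_sorted _ _) _.
by rewrite -(perm_cons d) -(perm_sort geq) eq_sort perm_sort.
Qed.

Lemma f_add_part (n d : nat) : 0 < d ->
  f (n + d) d = #|[pred mu : intpart n | has_fixed_point_slot d mu]|.
Proof.
move=> d_gt0; rewrite -(fintype.card_image (add_part_inj n d d_gt0)).
apply: eq_card => lam; rewrite !inE; apply/idP/fintype.imageP => [d_lam | [mu]].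
  (* A fixed point [d] is a part of [lam], so deleting one copy of [d] gives the preimage. *)
  have lam_sorted := intpart_sorted _ lam.
  have lam_perm := perm_to_rem (has_fixed_point_mem _ _ d_gt0 d_lam).
  have rem_sorted : sorted geq (rem d lam).
    exact: (subseq_sorted geq_trans (rem_subseq d lam)).
  have remP : is_intpart n (rem d lam).
    by rewrite -(is_intpart_insert _ _ _ _ d_gt0 rem_sorted lam_sorted lam_perm) (valP lam).
  exists (IntPart remP); first by rewrite inE -(has_fixed_point_insert _ _ _ lam_sorted).
  apply/val_inj/(sorted_eq geq_trans geq_anti) => //=.
    exact: sort_sorted geq_total _.
  by rewrite perm_sym perm_sort perm_sym.
rewrite inE => mu_d ->; rewrite (has_fixed_point_insert _ mu) ?perm_sort //.
exact: intpart_sorted.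
Qed.

Lemma f_add_eq0 (n d : nat) : n.+1 < d -> f (n + d) d = 0.
Proof.
move=> lt_nd; rewrite f_add_part ?(leq_ltn_trans _ lt_nd) //.
apply: eq_card0 => mu; rewrite inE; apply/negP.
case/has_fixed_point_slot_bounds/andP=> _; rewrite leqNgt.
by rewrite (leq_ltn_trans _ lt_nd) // ltnS intpart_size_leq.
Qed.

Lemma sum_f_add (n : nat) : \sum_(1 <= d < n.+2) f (n + d) d = p n.
Proof.
rewrite big_nat.
under eq_bigr => d /andP[d_gt0 _] do rewrite f_add_part // -sum1_card big_mkcond.
(* After the exchange, each [mu] contributes the number of its slots in the range, which is 1. *)
rewrite -big_nat exchange_big /= /p -sum1_card; apply: eq_bigr => mu _.
have [d mu_d] := has_fixed_point_slot_ex mu.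
have /andP[d_gt0 le_d] := has_fixed_point_slot_bounds _ _ mu_d.
rewrite (bigD1_seq d) ?iota_uniq //=; last first.
  (* The range reaches far enough: a slot is at most [(size mu).+1], hence at most [n.+1]. *)
  by rewrite mem_index_iota d_gt0 ltnS (leq_trans le_d) // ltnS intpart_size_leq.
rewrite inE mu_d big1 ?addn0 // => e ne_ed; rewrite inE; case: ifP => // mu_e.
by rewrite (has_fixed_point_slot_uniq _ _ _ mu_e mu_d) eqxx in ne_ed.
Qed.

Theorem theorem1p4 (n : nat) (hn : 1 <= n) :
  finite_set [set d : nat | 1 <= d /\ f (n + d - 1) d <> 0]
  /\ \big[addn/0]_(d \in [set d : nat | 1 <= d]) f (n + d - 1) d = p (n - 1).
Proof.
case: n hn => // n _.
have fE d : n.+1 + d - 1 = n + d by rewrite addSn subn1.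
split.
  apply: sub_finite_set (finite_II n.+2) => d /= [_]; rewrite fE ltnNge => fd.
  by apply/negP => /f_add_eq0.
rewrite subn1 -sum_f_add; under eq_fsbigr do rewrite fE.
(* Passing from the finite range to all [d >= 1] adds only terms with [d > n.+1], which vanish. *)
rewrite [RHS]fsbig_seq ?iota_uniq //=; apply/esym/fsbig_widen => d /=.
  by rewrite mem_index_iota; case/andP.
by rewrite mem_index_iota => -[d_gt0 /negP]; rewrite d_gt0 -leqNgt; apply: f_add_eq0.
Qed.
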